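(* The algebra of constants $(K\langle x,y\rangle)^{\delta}$, where $\delta(x)=0$, $\delta(y)=x$, is generated by $x$ and by $SL_2(K)$-invariants.
   Context: $K$ is a field of characteristic $0$ and $K\langle x,y\rangle$ is the free unitary associative $K$-algebra on $x,y$. $GL_2(K)$ acts naturally on $Kx\oplus Ky$ and diagonally on $K\langle x,y\rangle$ by algebra automorphisms; $SL_2(K)$-invariants are the elements of $K\langle x,y\rangle$ fixed by $SL_2(K)$. $\delta$ is the derivation of $K\langle x,y\rangle$ with $\delta(x)=0$, $\delta(y)=x$, and $(K\langle x,y\rangle)^{\delta}=\ker\delta$. *)

(* Defs.v *)
From HB Require Import structures.
From mathcomp Require Import all_boot all_order all_algebra.
From mathcomp Require Import finmap.
From mathcomp.multinomials Require Import monalg.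

Set Implicit Arguments.
Unset Strict Implicit.
Unset Printing Implicit Defensive.

Import GRing.Theory.

Local Open Scope ring_scope.

(* K<x, y> is the algebra of the free monoid on two letters 0 (for x) and
   1 (for y); the empty word is its unit. *)
Definition freealg2 (K : fieldType) : Type := {malg K[{fmonom 'I_2}]}.

HB.instance Definition _ (K : fieldType) := GRing.Lalgebra.on (freealg2 K).

Definition fvar (K : fieldType) (i : 'I_2) : freealg2 K := << fmu i >>.
Definition fx (K : fieldType) : freealg2 K := fvar K 0.
Definition fy (K : fieldType) : freealg2 K := fvar K 1.

(* The K-linear extension to K<x, y> of a map defined on words. *)
Definition word_ext (K : fieldType) (h : seq 'I_2 -> freealg2 K)
    (f : freealg2 K) : freealg2 K :=
  mmap (@malgC {fmonom 'I_2} K) (fun w : {fmonom 'I_2} => h w) f.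

Definition subst_word (K : fieldType) (u : 'I_2 -> freealg2 K)
    (w : seq 'I_2) : freealg2 K :=
  \prod_(i <- w) u i.

(* On Kx (+) Ky the matrix g acts by left multiplication on coordinate columns
   in the basis (x, y): the j-th variable goes to \sum_i g_ij X_i. *)
Definition lin_act (K : fieldType) (g : 'M[K]_2) (j : 'I_2) : freealg2 K :=
  \sum_(i < 2) g i j *: fvar K i.

(* Defined for all 2 x 2 matrices; a group action on invertible ones. *)
Definition gl2_act (K : fieldType) (g : 'M[K]_2) : freealg2 K -> freealg2 K :=
  word_ext (subst_word (lin_act g)).

Definition sl2_invariant (K : fieldType) (f : freealg2 K) : Prop :=
  forall g : 'M[K]_2, \det g = 1 -> gl2_act g f = f.

(* The value on a word of the derivation sending the i-th variable to d i:
   Leibniz' rule on X_i * w. *)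
Fixpoint der_word (K : fieldType) (d : 'I_2 -> freealg2 K) (w : seq 'I_2) :
    freealg2 K :=
  if w is i :: w' then
    d i * subst_word (fvar K) w' + fvar K i * der_word d w'
  else 0.

Definition delta (K : fieldType) : freealg2 K -> freealg2 K :=
  word_ext (der_word (fun i => if i == 0 then 0 else fx K)).

Inductive gen_subalg (K : fieldType) (A : lalgType K) (S : A -> Prop) :
    A -> Prop :=
| gen_subalg_in a of S a : gen_subalg S a
| gen_subalg_1 : gen_subalg S 1
| gen_subalg_D a b of gen_subalg S a & gen_subalg S b : gen_subalg S (a + b)
| gen_subalg_Z (c : K) a of gen_subalg S a : gen_subalg S (c *: a)
| gen_subalg_M a b of gen_subalg S a & gen_subalg S b : gen_subalg S (a * b).

Section Theory.

Variable K : fieldType.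
Local Notation A := (freealg2 K).
Implicit Types (f g : A) (c : K) (w : {fmonom 'I_2}).

Lemma word_extU h c w : word_ext h (<< c *g w >> : A) = c *: h w.
Proof. by rewrite /word_ext mmapU mul_malgC. Qed.

Lemma word_ext0 h : word_ext h (0 : A) = 0.
Proof. exact: mmap0. Qed.

Lemma word_extD h f g : word_ext h (f + g) = word_ext h f + word_ext h g.
Proof. exact: mmapD. Qed.

Lemma freealg2_ind (P : A -> Prop) :
  P 0 -> (forall f g, P f -> P g -> P (f + g)) ->
  (forall c w, P << c *g w >>) -> forall f, P f.
Proof.
move=> P0 PD PU f; rewrite [f]monalgE.
by elim/big_ind: _ => // w _; exact: PU.
Qed.

Lemma freealg2_scaleU c c' w : c *: (<< c' *g w >> : A) = << c * c' *g w >>.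
Proof. apply/malgP=> v; rewrite mcoeffZ [in LHS]mcoeffU [in RHS]mcoeffU.
exact: mulrnAr. Qed.

Lemma freealg2_mulU c c' w w' :
  (<< c *g w >> : A) * << c' *g w' >> = << c * c' *g mmul w w' >>.
Proof. by rewrite malgM_def fgmulUU. Qed.

Lemma freealg2_scaleAr c f g : c *: (f * g) = f * (c *: g).
Proof.
suff C h : GRing.comm h (c%:MP : A) by rewrite -!mul_malgC [RHS]mulrA C mulrA.
elim/freealg2_ind: h => [|h h' IH IH'|c1 w1].
- exact/commr_sym/commr0.
- exact/commr_sym/commrD/commr_sym/IH'/commr_sym/IH.
by rewrite /GRing.comm !freealg2_mulU mulm1 mul1m mulrC.
Qed.

HB.instance Definition _ :=
  GRing.Lalgebra_isAlgebra.Build K A freealg2_scaleAr.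

Lemma word_extZ h c f : word_ext h (c *: f) = c *: word_ext h f.
Proof.
elim/freealg2_ind: f => [|f g IH IH'|c1 w1].
- by rewrite scaler0 word_ext0 scaler0.
- rewrite scalerDr; apply: etrans (word_extD _ _ _) _.
  apply: etrans (f_equal2 +%R IH IH') _.
  by rewrite [in RHS]word_extD; exact/esym/scalerDr.
by rewrite freealg2_scaleU [LHS]word_extU [in RHS]word_extU scalerA.
Qed.

Lemma subst_word_cat u (s t : seq 'I_2) :
  subst_word u (s ++ t) = subst_word u s * subst_word u t :> A.
Proof. exact: big_cat. Qed.

Lemma subst_word_var w : subst_word (fvar K) w = << w >>.
Proof.
case: w => s; elim: s => [|i s IH]; rewrite /subst_word.
  by rewrite big_nil; congr (<< _ >>); apply/eqP; rewrite fmP fm1.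
rewrite big_cons -/(subst_word _ _) IH freealg2_mulU mulr1.
by congr (<< _ >>); apply/eqP; rewrite fmP fmM fmU.
Qed.

Lemma word_ext_subst1 u : word_ext (subst_word u) (1 : A) = 1.
Proof. by rewrite word_extU fm1 scale1r /subst_word big_nil. Qed.

Lemma word_ext_substM u f g :
  word_ext (subst_word u) (f * g) =
  word_ext (subst_word u) f * word_ext (subst_word u) g.
Proof.
elim/freealg2_ind: f => [|f f' IH IH'|c1 w1].
- by rewrite mul0r word_ext0 mul0r.
- rewrite mulrDl; apply: etrans (word_extD _ _ _) _.
  apply: etrans (f_equal2 +%R IH IH') _.
  by rewrite [in RHS]word_extD; exact/esym/mulrDl.
elim/freealg2_ind: g => [|g g' IH IH'|c2 w2].
- by rewrite mulr0 word_ext0 mulr0.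
- rewrite mulrDr; apply: etrans (word_extD _ _ _) _.
  apply: etrans (f_equal2 +%R IH IH') _.
  by rewrite [in RHS]word_extD; exact/esym/mulrDr.
rewrite freealg2_mulU !word_extU fmM subst_word_cat.
by rewrite -scalerAl -freealg2_scaleAr scalerA.
Qed.

Lemma word_ext_subst_var u i : word_ext (subst_word u) (fvar K i) = u i.
Proof. by rewrite word_extU fmU scale1r /subst_word big_seq1. Qed.

Lemma gl2_act1 m : gl2_act m (1 : A) = 1.
Proof. exact: word_ext_subst1. Qed.

Lemma gl2_act0 m : gl2_act m (0 : A) = 0.
Proof. exact: word_ext0. Qed.

Lemma gl2_actD m f g : gl2_act m (f + g) = gl2_act m f + gl2_act m g.
Proof. exact: word_extD. Qed.

Lemma gl2_actZ m c f : gl2_act m (c *: f) = c *: gl2_act m f.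
Proof. exact: word_extZ. Qed.

Lemma gl2_actM m f g : gl2_act m (f * g) = gl2_act m f * gl2_act m g.
Proof. exact: word_ext_substM. Qed.

Lemma gl2_act_var m j : gl2_act m (fvar K j) = \sum_(i < 2) m i j *: fvar K i.
Proof. exact: word_ext_subst_var. Qed.

Lemma gl2_act_comp m n f : gl2_act (m *m n) f = gl2_act m (gl2_act n f).
Proof.
have actS (I : Type) (r : seq I) (F : I -> A) :
    gl2_act m (\sum_(i <- r) F i) = \sum_(i <- r) gl2_act m (F i).
  by apply: big_morph => [f1 f2|]; rewrite ?gl2_act0 // gl2_actD.
have var j : lin_act (m *m n) j = gl2_act m (lin_act n j).
  rewrite /lin_act actS; under [RHS]eq_bigr do
    rewrite gl2_actZ gl2_act_var scaler_sumr.
  rewrite exchange_big; apply: eq_bigr => i _; rewrite mxE scaler_suml.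
  by apply: eq_bigr => k _; rewrite scalerA mulrC.
elim/freealg2_ind: f => [|f g IH IH'|c w].
- by rewrite !gl2_act0.
- by rewrite (gl2_actD (m *m n)) IH IH' (gl2_actD n) gl2_actD.
have -> : gl2_act n << c *g w >> = c *: subst_word (lin_act n) w.
  exact: word_extU.
have -> : gl2_act (m *m n) << c *g w >> = c *: subst_word (lin_act (m *m n)) w.
  exact: word_extU.
rewrite gl2_actZ; congr (_ *: _); rewrite /subst_word.
elim: (w : seq _) => [|i s IH]; first by rewrite [LHS]big_nil big_nil gl2_act1.
by rewrite [LHS]big_cons [in RHS]big_cons gl2_actM -var -IH.
Qed.

Lemma der_word_cat (d : 'I_2 -> A) (s t : seq 'I_2) :
  der_word d (s ++ t) =
  der_word d s * subst_word (fvar K) t + subst_word (fvar K) s * der_word d t.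
Proof.
elim: s => [|i s IH] /=; first by rewrite mul0r add0r /subst_word big_nil mul1r.
have -> : subst_word (fvar K) (i :: s) = fvar K i * subst_word (fvar K) s.
  exact: big_cons.
rewrite IH subst_word_cat.
have leibniz (R : nzRingType) (a b p q p' q' : R) :
    a * (p * q) + b * (p' * q + p * q') = (a * p + b * p') * q + b * p * q'.
  by rewrite mulrDl mulrDr !mulrA addrA.
exact: leibniz.
Qed.

Lemma delta0 : delta (0 : A) = 0.
Proof. exact: word_ext0. Qed.

Lemma deltaD f g : delta (f + g) = delta f + delta g.
Proof. exact: word_extD. Qed.

Lemma deltaZ c f : delta (c *: f) = c *: delta f.
Proof. exact: word_extZ. Qed.

Lemma deltaM f g : delta (f * g) = delta f * g + f * delta g.
Proof.
have addACl (R : nzRingType) (a a' b b' p q : R) :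
    a * p + b * q + (a' * p + b' * q) = (a + a') * p + (b + b') * q.
  by rewrite !mulrDl addrACA.
have addACr (R : nzRingType) (a b p p' q q' : R) :
    a * p + b * q + (a * p' + b * q') = a * (p + p') + b * (q + q').
  by rewrite !mulrDr addrACA.
have scaleAC (R : algType K) (c1 c2 : K) (a b p q : R) :
    (c1 * c2) *: (a * p + b * q) =
    (c1 *: a) * (c2 *: p) + (c1 *: b) * (c2 *: q).
  by rewrite -!scalerAl -!scalerAr !scalerA scalerDr.
elim/freealg2_ind: f => [|f f' IH IH'|c1 w1].
- by rewrite mul0r delta0 !mul0r addr0.
- rewrite mulrDl; apply: etrans (deltaD _ _) _.
  apply: etrans (f_equal2 +%R IH IH') _; rewrite [in RHS]deltaD.
  exact: addACl.
elim/freealg2_ind: g => [|g g' IH IH'|c2 w2].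
- by rewrite mulr0 delta0 !mulr0 addr0.
- rewrite mulrDr; apply: etrans (deltaD _ _) _.
  apply: etrans (f_equal2 +%R IH IH') _; rewrite [in RHS]deltaD.
  exact: addACr.
have UE c w : << c *g w >> = c *: subst_word (fvar K) w.
  by rewrite subst_word_var freealg2_scaleU mulr1.
rewrite freealg2_mulU {1}/delta word_extU fmM der_word_cat.
have dE c w : delta << c *g w >> = c *: der_word _ w := word_extU _ c w.
by rewrite (dE c1) (dE c2) (UE c1) (UE c2); exact: scaleAC.
Qed.

Lemma delta_x : delta (fx K) = 0.
Proof. by rewrite /delta word_extU fmU /= mul0r mulr0 addr0 scaler0. Qed.

Lemma delta_y : delta (fy K) = fx K.
Proof.
by rewrite /delta word_extU fmU /= mulr0 addr0 /subst_word big_nil mulr1 scale1r.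
Qed.

End Theory.

(* Main.v *)
From HB Require Import structures.
Require Import Defs.
From mathcomp Require Import all_boot all_order all_algebra.
From mathcomp Require Import ring.
Import GRing.Theory.
Local Open Scope ring_scope.

Set Implicit Arguments.
Unset Strict Implicit.
Unset Printing Implicit Defensive.

(** Write [D] for the derivation [delta].

    Invariants are constants: the substitution fixing [x] and sending [y] to
    [x + y] lies in SL_2 and equals exp([D]), and [D] is locally nilpotent, so
    a fixed vector of exp([D]) is killed by [D] ([D_sl2_fixed]).

    Conversely, let [D f = 0] with [f = c + x a + y b].  Comparing the terms of
    [D f] that start with [x] and with [y] gives [D a = - b] and [D b = 0].  By
    induction on the degree, [b] is a sum of products [u x s], with [u]
    invariant and [s] a generated constant, and of one further invariant [v].
    Each [u x s] is [D (u y s)], so [b = v + D r] with [r] explicit, and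
    [v = - D (a + r)].  Two facts finish the proof.

    - A nonzero invariant is never in the image of [D] ([sl2_fixed_im_D]).
      This is sl_2 theory: with the opposite derivation [E] and [H = [E, D]],
      if [D z = u] is killed by [D] and [E] then [D^(n+1) E^n z] equals
      [n! (n+1)! u], and [E] is locally nilpotent.  Hence [v = 0].
    - Now [D (a + r) = 0], so [a + r] is generated by induction, and
      [f = c + x (a + r) - (x r - y D r)].  The last parenthesis is a sum of
      terms [(x u y - y u x) s], where [x u y - y u x] is again invariant
      because SL_2 acts on it through the determinant ([sl2_fixed_bracket]).

    The explicit form of [r] also keeps its degree below that of [f]; the
    induction needs this, and [span_le] records it. *)

Section IterLinear.

Variables (K : fieldType) (V : lmodType K) (F : {linear V -> V}).

Lemma iter_linear0 n : iter n F 0 = 0.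
Proof. by elim: n => //= n ->; rewrite linear0. Qed.

Lemma iter_linearD n v w : iter n F (v + w) = iter n F v + iter n F w.
Proof. by elim: n => //= n ->; rewrite linearD. Qed.

Lemma iter_linearZ n c v : iter n F (c *: v) = c *: iter n F v.
Proof. by elim: n => //= n ->; rewrite linearZ. Qed.

Lemma iter_linear_sum (I : Type) (r : seq I) n (G : I -> V) :
  iter n F (\sum_(i <- r) G i) = \sum_(i <- r) iter n F (G i).
Proof. by elim: n => //= n ->; rewrite raddf_sum. Qed.

End IterLinear.

(** * Raising and lowering in sl_2-modules *)

Section Sl2Module.

Variables (K : fieldType) (V : lmodType K) (D E H : {linear V -> V}).

Hypothesis DE : forall v, D (E v) = E (D v) - H v.
Hypothesis HE : forall v, H (E v) = E (H v) - 2%:R *: E v.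
Hypothesis HD : forall v, H (D v) = D (H v) + 2%:R *: D v.

Lemma sl2_weight_lower n v :
  H (iter n E v) = iter n E (H v) - (2 * n)%:R *: iter n E v.
Proof.
elim: n => [|n IH]; first by rewrite muln0 scale0r subr0.
rewrite iterS HE IH linearB /= linearZ /= -addrA -opprD -scalerDl -natrD.
by rewrite mulnS addnC.
Qed.

(** The commutation of [D] past a power of [E] in U(sl_2); no weight vectors
    are involved, so no weight decomposition of [v] is needed later. *)
Lemma sl2_raise_lower n v :
  D (iter n.+1 E v) =
  iter n.+1 E (D v) - n.+1%:R *: iter n E (H v - n%:R *: v).
Proof.
elim: n v => [|n IH] v; first by rewrite /= scale0r subr0 scale1r DE.
rewrite (iterS n.+1 E v) DE IH sl2_weight_lower linearB linearZ /= -addrA.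
congr (_ + _); rewrite -!scaleNr !iter_linearD !iter_linearZ /=.
rewrite !linearD !linearZ /=.
move: (E (iter n E (H v))) (E (iter n E v)) => a b.
rewrite -[- a]scaleN1r scalerN -scaleNr !scalerA addrACA -!scalerDl.
by congr (_ *: a + _ *: b); rewrite ?natrM -!natr1; ring.
Qed.

(** Induction on [n] after one application of [sl2_raise_lower]: it replaces
    [z] by [H z - n z], whose image under [D] is again a multiple of [u].  The
    scalar [c] is there to absorb that multiple. *)
Lemma sl2_iter_raise_lower u c n z :
  D u = 0 -> E u = 0 -> D z = c *: u ->
  iter n.+1 D (iter n E z) = (c * n`!%:R * n.+1`!%:R) *: u.
Proof.
move=> Du Eu.
have Hu : H u = 0.
  have := DE u; rewrite Eu Du !linear0 sub0r => /esym/eqP.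
  by rewrite oppr_eq0 => /eqP.
elim: n c z => [|n IH] c z Dz; first by rewrite /= Dz !mulr1.
rewrite iterSr sl2_raise_lower Dz (iterSr n E) linearZ /= Eu scaler0.
rewrite iter_linear0 sub0r -[- (n.+1%:R *: _)]scaleNr -iterS iter_linearZ.
(* [D z = c u] and [H u = 0] give [D (H z - n z) = - (n + 2) c u]. *)
rewrite (IH (- (c * n.+2%:R))).
  rewrite scalerA; congr (_ *: u).
  by rewrite (factS n.+1) (factS n) !natrM -!natr1; ring.
have -> : D (H z - n%:R *: z) = H (D z) - 2%:R *: D z - n%:R *: D z.
  by rewrite linearB linearZ /= HD addrK.
rewrite Dz linearZ /= Hu scaler0 sub0r !scalerA -!scaleNr -scalerDl.
by congr (_ *: u); rewrite -!natr1; ring.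
Qed.

Lemma sl2_invariant_image_eq0 (charK0 : [pchar K] =i pred0) u z n :
  D u = 0 -> E u = 0 -> D z = u -> iter n E z = 0 -> u = 0.
Proof.
move=> Du Eu Dz Enz.
have := sl2_iter_raise_lower (c := 1) n Du Eu; rewrite scale1r => /(_ _ Dz).
have natK m : (m%:R == 0 :> K) = (m == 0%N) by move/pcharf0P: charK0; exact.
rewrite Enz iter_linear0.
move/esym/eqP; rewrite scaler_eq0 mul1r mulf_eq0 !natK.
by rewrite !eqn0Ngt !fact_gt0 => /eqP.
Qed.

End Sl2Module.

(** * Derivations and two by two matrices *)

Section Derivations.

Variables (K : fieldType) (R : algType K).

Definition leibniz (D : R -> R) := forall f g, D (f * g) = D f * g + f * D g.

Lemma leibniz1 (F : {linear R -> R}) : leibniz F -> F 1 = 0.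
Proof.
move=> FM; have := FM 1 1; rewrite !mulr1 mul1r => /eqP.
by rewrite -{1}[F 1]addr0 (inj_eq (addrI _)) => /eqP/esym.
Qed.

Lemma leibniz_comm (D E : {linear R -> R}) :
  leibniz D -> leibniz E -> leibniz ((D \o E) \- (E \o D)).
Proof.
have addACK (V : zmodType) (a b c d p q : V) :
    (a + p) + (q + b) - ((c + q) + (p + d)) = (a - c) + (b - d).
  rewrite (addrC q b) (addrC p d) addrACA [in X in _ - X]addrACA (addrC q p).
  by rewrite opprD [LHS]addrACA subrr addr0 opprD addrACA.
move=> DM EM f g /=; rewrite EM DM !linearD /= !EM !DM mulrBl mulrBr.
by rewrite -[X in _ + X]opprD; exact: addACK.
Qed.

End Derivations.

Lemma sum_ord2 (V : nmodType) (F : 'I_2 -> V) : \sum_i F i = F 0 + F 1.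
Proof.
rewrite !big_ord_recl big_ord0 addr0; congr (_ + F _); exact/val_inj.
Qed.

Lemma det2 (R : comNzRingType) (m : 'M[R]_2) :
  \det m = m 0 0 * m 1 1 - m 0 1 * m 1 0.
Proof.
rewrite (expand_det_row _ 0) !big_ord_recl big_ord0 addr0 /cofactor !det_mx11.
rewrite !mxE /= expr0 expr1 mul1r mulN1r mulrN.
by congr (m _ _ * m _ _ - m _ _ * m _ _); exact/val_inj.
Qed.

(** * SL_2 acting on a free algebra *)

(** The free algebra on [x] and [y] enters through an induction principle
    (words are built by multiplying by a letter on the left) and through the
    independence of [x] and [y] over right multipliers. *)
Section FreeAlgebra.

Variables (K : fieldType) (A : algType K) (x y : A).
Variables (D : {linear A -> A}) (act : 'M[K]_2 -> {lrmorphism A -> A}).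

Hypothesis left_ind : forall P : A -> Prop,
  P 1 -> (forall f g, P f -> P g -> P (f + g)) ->
  (forall c f, P f -> P (c *: f)) ->
  (forall f, P f -> P (x * f)) -> (forall f, P f -> P (y * f)) ->
  forall f, P f.
Hypothesis left_free : forall a b, x * a + y * b = 0 -> a = 0 /\ b = 0.
Hypothesis DM : leibniz D.
Hypothesis Dx : D x = 0.
Hypothesis Dy : D y = x.
Hypothesis act_x : forall m, act m x = m 0 0 *: x + m 1 0 *: y.
Hypothesis act_y : forall m, act m y = m 0 1 *: x + m 1 1 *: y.

Implicit Types (f g u : A) (c : K) (n : nat).

Lemma leibniz_eq (F G : {linear A -> A}) :
  leibniz F -> leibniz G -> F x = G x -> F y = G y -> F =1 G.
Proof.
move=> FM GM eqx eqy; apply: left_ind => [|f g Ff Fg|c f Ff|f Ff|f Ff].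
- by rewrite !leibniz1.
- by rewrite !linearD /= Ff Fg.
- by rewrite !linearZ /= Ff.
- by rewrite FM GM eqx Ff.
- by rewrite FM GM eqy Ff.
Qed.

Lemma lrmorphism_eq (F G : {lrmorphism A -> A}) :
  F x = G x -> F y = G y -> F =1 G.
Proof.
move=> eqx eqy; apply: left_ind => [|f g Ff Fg|c f Ff|f Ff|f Ff].
- by rewrite !rmorph1.
- by rewrite !linearD /= Ff Fg.
- by rewrite !linearZ /= Ff.
- by rewrite !rmorphM /= Ff eqx.
- by rewrite !rmorphM /= Ff eqy.
Qed.

Definition sl2_fixed u := forall m, \det m = 1 -> act m u = u.

Lemma sl2_fixedD u v : sl2_fixed u -> sl2_fixed v -> sl2_fixed (u + v).
Proof. by move=> uI vI m detm; rewrite linearD /= uI ?vI. Qed.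

Lemma sl2_fixedZ c u : sl2_fixed u -> sl2_fixed (c *: u).
Proof. by move=> uI m detm; rewrite linearZ /= uI. Qed.

Lemma sl2_fixedM u v : sl2_fixed u -> sl2_fixed v -> sl2_fixed (u * v).
Proof. by move=> uI vI m detm; rewrite rmorphM /= uI ?vI. Qed.

Lemma sl2_fixed0 : sl2_fixed 0.
Proof. by move=> m _; rewrite linear0. Qed.

Lemma sl2_fixed1 : sl2_fixed 1.
Proof. by move=> m _; rewrite rmorph1. Qed.

(** The antisymmetric combination spans the determinant representation of the
    linear span of [x] and [y], whatever fixed element stands in the middle. *)
Lemma sl2_fixed_bracket u :
  sl2_fixed u -> sl2_fixed (x * u * y - y * u * x).
Proof.
move=> uI m detm; rewrite linearB /= !rmorphM /= (uI m) // act_x act_y.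
have addACK (V : zmodType) (p q q' r r' s : V) :
    p + q + (r + s) - (p + q' + (r' + s)) = (q - q') + (r - r').
  by rewrite opprD addrACA (addrC p q) (addrC r' s) !addrKA.
have bracketE (a b c d : K) :
    (a *: x + b *: y) * u * (c *: x + d *: y) -
    (c *: x + d *: y) * u * (a *: x + b *: y) =
    (a * d - c * b) *: (x * u * y - y * u * x).
  rewrite !mulrDl !mulrDr -!scalerAr -!scalerAl !scalerA.
  rewrite (mulrC c a) (mulrC d a) (mulrC d b) (mulrC b c) addACK.
  by rewrite -!scalerBl scalerBr -[in RHS]scaleNr opprB.
by rewrite bracketE -det2 detm scale1r.
Qed.

Lemma iter_mulxE n f : iter n D (x * f) = x * iter n D f.
Proof. by elim: n => //= n ->; rewrite DM Dx mul0r add0r. Qed.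

Lemma iter_mulyE n f :
  iter n.+1 D (y * f) = y * iter n.+1 D f + n.+1%:R *: (x * iter n D f).
Proof.
elim: n => [|n IH]; first by rewrite /= DM Dy scale1r addrC.
rewrite iterS IH linearD linearZ /= !DM Dx Dy mul0r add0r addrC addrA.
by rewrite addrC -[n.+2]addn1 natrD scalerDl scale1r.
Qed.

(** The matrix of [x |-> x], [y |-> x + y], that is of exp([D]). *)
Definition unip : 'M[K]_2 := \matrix_(i, j) (i <= j)%N%:R.

Hypothesis charK0 : [pchar K] =i pred0.

Let natK n : n.+1%:R != 0 :> K.
Proof. by move/pcharf0P: charK0 => ->. Qed.

(** The truncated exponential series at every large enough order.  It suffices
    to follow left multiplication by [x] and by [y]; for [y], the two terms of
    [iter_mulyE] match the two terms of the image [x + y] of [y]. *)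
Lemma act_unip_exp f : exists N, forall n, (N <= n)%N ->
  iter n D f = 0 /\ act unip f = \sum_(k < n) k`!%:R^-1 *: iter k D f.
Proof.
elim/left_ind: f => [|f g [M IHf] [N IHg]|c f [N IH]|f [N IH]|f [N IH]].
- exists 1%N => -[//|n] _; rewrite iterSr (leibniz1 DM) iter_linear0.
  split=> //; rewrite rmorph1 big_ord_recl big1 => [|k _] /=.
    by rewrite invr1 scale1r addr0.
  by rewrite -iterS iterSr (leibniz1 DM) iter_linear0 scaler0.
- exists (maxn M N) => n; rewrite geq_max => /andP[/IHf[Df ef] /IHg[Dg eg]].
  rewrite iter_linearD Df Dg addr0 linearD /= ef eg -big_split; split=> //.
  by apply: eq_bigr => k _; rewrite iter_linearD scalerDr.
- exists N => n /IH[Df ef].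
  rewrite iter_linearZ Df scaler0 linearZ /= ef scaler_sumr.
  by split=> //; apply: eq_bigr => k _; rewrite iter_linearZ !scalerA mulrC.
- exists N => n /IH[Df ef]; rewrite iter_mulxE Df mulr0 rmorphM /= ef.
  rewrite act_x !mxE /= scale1r scale0r addr0 mulr_sumr; split=> //.
  by apply: eq_bigr => k _; rewrite iter_mulxE scalerAr.
exists N.+1 => -[//|n] leNn; have [Df ef] := IH n leNn.
rewrite iter_mulyE Df iterS Df linear0 !mulr0 scaler0 add0r; split=> //.
have [_ ef'] := IH n.+1 (leqW leNn).
rewrite rmorphM /= act_y !mxE /= !scale1r mulrDl {1}ef ef' addrC.
rewrite !big_ord_recl /= mulrDr -scalerAr -!addrA; congr (_ + _).
rewrite !mulr_sumr -big_split; apply: eq_bigr => k _ /=.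
have -> : D (iter (0 + k) D (y * f)) =
  y * iter k.+1 D f + k.+1%:R *: (x * iter k D f) := iter_mulyE k f.
rewrite scalerDr -!scalerAr scalerA; congr (_ + _ *: _).
by rewrite factS natrM invfM mulrAC mulVf ?mul1r // natK.
Qed.

Lemma D_sl2_fixed u : sl2_fixed u -> D u = 0.
Proof.
move=> uI; have [N expu] := act_unip_exp u.
have uE : act unip u = u.
  by apply: uI; rewrite det2 !mxE /= !mulr1 mulr0 subr0.
suff kill m : iter m.+1 D u = 0 -> D u = 0.
  by apply: (kill N); have [|] := expu N.+1.
(* [D^m] of exp([D]) u - u = 0 leaves only [D^(m+1) u]: the higher terms
   vanish by [Dm]. *)
elim: m => [//|m IH] Dm; apply: IH.
have [_] := expu N.+2 (leqW (leqnSn N)); rewrite uE !big_ord_recl /=.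
rewrite fact0 !invr1 !scale1r => /eqP; rewrite -{1}[u]addr0 (inj_eq (addrI _)).
move=> /eqP/esym/(congr1 (iter m D)).
rewrite iter_linearD iter_linear0 -iterSr iter_linear_sum big1 ?addr0 // => k _.
rewrite iter_linearZ -[D (D _)]/(iter k.+2 D u) -iterD.
by rewrite addnC addSnnS addSn -addnS iterD Dm iter_linear0 scaler0.
Qed.

(** The quarter turn [x |-> y], [y |-> - x], with entries [i - j]. *)
Definition rot : 'M[K]_2 := \matrix_(i, j) ((i : nat)%:R - (j : nat)%:R).

Local Notation simp := (subrr, subr0, sub0r, scale0r, scaler0, scaleN1r,
  scale1r, oppr0, opprK, addr0, add0r).

Lemma rotK : act rot \o act (- rot) =1 id.
Proof.
by apply: (@lrmorphism_eq _ idfun); rewrite /= ?act_x ?act_y linearD /=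
  !linearZ /= act_x act_y !mxE /= ?simp.
Qed.

Lemma rotNK : act (- rot) \o act rot =1 id.
Proof.
by apply: (@lrmorphism_eq _ idfun); rewrite /= ?act_x ?act_y linearD /=
  !linearZ /= act_x act_y !mxE /= ?simp.
Qed.

(** The derivation [x |-> - y], [y |-> 0], obtained as a conjugate of [D] so
    that local nilpotency and the vanishing on fixed elements are inherited. *)
Definition lower : {linear A -> A} := act rot \o D \o act (- rot).

(** The derivation [x |-> x], [y |-> - y]. *)
Definition weight : {linear A -> A} := (lower \o D) \- (D \o lower).

Lemma lower_leibniz : leibniz lower.
Proof.
move=> f g; rewrite /= rmorphM /= DM linearD /= !rmorphM /=.
by have /= -> := rotK f; have /= -> := rotK g.
Qed.

Lemma weight_leibniz : leibniz weight.
Proof. exact: leibniz_comm lower_leibniz DM. Qed.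

Lemma lower_x : lower x = - y.
Proof.
rewrite /= act_x linearD !linearZ /= Dx Dy scaler0 add0r linearZ /=.
by rewrite act_x !mxE /= !simp.
Qed.

Lemma lower_y : lower y = 0.
Proof.
rewrite /= act_y linearD !linearZ /= Dx Dy scaler0 add0r linearZ /=.
by rewrite act_x !mxE /= !simp.
Qed.

Lemma weightE f : weight f = lower (D f) - D (lower f).
Proof. by []. Qed.

Lemma weight_x : weight x = x.
Proof. by rewrite weightE Dx lower_x linear0 linearN Dy sub0r opprK. Qed.

Lemma weight_y : weight y = - y.
Proof. by rewrite weightE Dy lower_x lower_y linear0 subr0. Qed.

(** A commutator of derivations is a derivation, so a bracket relation between
    derivations need only be checked on [x] and [y]. *)
Lemma comm_scale (F G : {linear A -> A}) c :
  leibniz F -> leibniz G -> F (G x) - G (F x) = c *: G x ->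
  F (G y) - G (F y) = c *: G y -> forall f, F (G f) = G (F f) + c *: G f.
Proof.
move=> FM GM eqx eqy f; apply/eqP; rewrite addrC -subr_eq; apply/eqP.
have cGM : leibniz (c \*: G).
  by move=> g h /=; rewrite GM scalerDr scalerAl scalerAr.
exact: (leibniz_eq (leibniz_comm FM GM) cGM).
Qed.

Lemma weight_lower f : weight (lower f) = lower (weight f) - 2%:R *: lower f.
Proof.
rewrite -scaleNr.
apply: comm_scale; [exact: weight_leibniz|exact: lower_leibniz|..].
  rewrite weight_x lower_x linearN weight_y opprK scalerN scaleNr opprK.
  by rewrite scaler_nat.
by rewrite weight_y lower_y linearN lower_y !linear0 addr0.
Qed.

Lemma weight_D f : weight (D f) = D (weight f) + 2%:R *: D f.
Proof.
apply: comm_scale; [exact: weight_leibniz|exact: DM|..].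
  by rewrite weight_x Dx linear0 subr0 scaler0.
by rewrite weight_y linearN Dy weight_x opprK scaler_nat.
Qed.

Lemma iter_lower n f : iter n lower f = act rot (iter n D (act (- rot) f)).
Proof.
elim: n => [|n IH]; first by have /= -> := rotK f.
by rewrite iterS IH /=; have /= -> := rotNK (iter n D (act (- rot) f)).
Qed.

Lemma lower_sl2_fixed u : sl2_fixed u -> lower u = 0.
Proof.
move=> uI; rewrite /= uI ?D_sl2_fixed ?linear0 // det2 !mxE /=.
by rewrite !(subrr, subr0, sub0r, oppr0, opprK, mul0r, mul1r, addr0).
Qed.

Lemma sl2_fixed_im_D u z : sl2_fixed u -> D z = u -> u = 0.
Proof.
move=> uI Dz.
have [N /(_ N (leqnn N)) [nilN _]] := act_unip_exp (act (- rot) z).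
apply: (sl2_invariant_image_eq0 _ weight_lower weight_D charK0 (n := N) _ _ Dz).
- by move=> v; rewrite weightE opprB addrC subrK.
- exact: D_sl2_fixed.
- exact: lower_sl2_fixed.
- by rewrite iter_lower nilN linear0.
Qed.

(** * Constants by induction on the degree *)

Fixpoint deg_le n f : Prop :=
  if n is n'.+1 then
    exists c a b, [/\ f = c *: 1 + (x * a + y * b), deg_le n' a & deg_le n' b]
  else exists c, f = c *: 1.

Lemma deg_leZ n c f : deg_le n f -> deg_le n (c *: f).
Proof.
elim: n f => [|n IH] f /= [d].
  by move=> ->; exists (c * d); rewrite scalerA.
move=> [a [b [-> da db]]]; exists (c * d), (c *: a), (c *: b).
by split; [rewrite !scalerDr scalerA !scalerAr|exact: IH|exact: IH].
Qed.

Lemma deg_leD n f g : deg_le n f -> deg_le n g -> deg_le n (f + g).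
Proof.
elim: n f g => [|n IH] f g /= [c].
  by move=> -> [d ->]; exists (c + d); rewrite scalerDl.
move=> [a [b [-> da db]]] [c' [a' [b' [-> da' db']]]].
exists (c + c'), (a + a'), (b + b'); split; [|exact: IH|exact: IH].
by rewrite scalerDl !mulrDr addrACA; congr (_ + _); rewrite addrACA.
Qed.

Lemma deg_le0 n : deg_le n 0.
Proof.
elim: n => [|n IH]; first by exists 0; rewrite scale0r.
by exists 0, 0, 0; rewrite scale0r !mulr0 !addr0.
Qed.

Lemma deg_leS n f : deg_le n f -> deg_le n.+1 f.
Proof.
elim: n f => [|n IH] f.
  move=> [c ->]; exists c, 0, 0; split; [|exact: deg_le0|exact: deg_le0].
  by rewrite !mulr0 !addr0.
by move=> [c [a [b [-> da db]]]]; exists c, a, b; split; [|exact: IH|exact: IH].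
Qed.

Lemma deg_leW m n f : (m <= n)%N -> deg_le m f -> deg_le n f.
Proof.
by move=> /subnK <-; elim: (n - m)%N => [|k IH] // /IH; exact: deg_leS.
Qed.

Lemma deg_le_x n f : deg_le n f -> deg_le n.+1 (x * f).
Proof.
move=> df; exists 0, f, 0; split; rewrite ?scale0r ?mulr0 ?addr0 ?add0r //.
exact: deg_le0.
Qed.

Lemma deg_le_y n f : deg_le n f -> deg_le n.+1 (y * f).
Proof.
move=> df; exists 0, 0, f; split; rewrite ?scale0r ?mulr0 ?addr0 ?add0r //.
exact: deg_le0.
Qed.

Lemma deg_le1 n : deg_le n 1.
Proof. by apply: (deg_leW (leq0n n)); exists 1; rewrite scale1r. Qed.

Lemma deg_leM m n f g : deg_le m f -> deg_le n g -> deg_le (m + n) (f * g).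
Proof.
move=> df dg; elim: m f df => [|m IH] f [c].
  by move=> ->; rewrite -scalerAl mul1r; exact: deg_leZ.
move=> [a [b [-> da db]]]; rewrite !mulrDl -scalerAl mul1r -!mulrA.
apply: deg_leD; first by apply: deg_leZ; apply: deg_leW dg; rewrite leq_addl.
by apply: deg_leD; [apply: deg_le_x|apply: deg_le_y]; exact: IH.
Qed.

Lemma deg_le_ex f : exists n, deg_le n f.
Proof.
elim/left_ind: f => [|f g [m df] [n dg]|c f [n df]|f [n df]|f [n df]].
- by exists 0%N; exact: deg_le1.
- exists (maxn m n); apply: deg_leD.
    exact: deg_leW (leq_maxl m n) df.
  exact: deg_leW (leq_maxr m n) dg.
- by exists n; exact: deg_leZ.
- by exists n.+1; exact: deg_le_x.
- by exists n.+1; exact: deg_le_y.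
Qed.

(** Sums of [u_0 x u_1 x ... x u_k] with fixed [u_i], of degree at most [n].  A
    summand is either fixed or in the image of [D] in a visible way. *)
Inductive span_le : nat -> A -> Prop :=
| span_inv n u of sl2_fixed u & deg_le n u : span_le n u
| span_cons k m n u s of (k + m < n)%N & sl2_fixed u & deg_le k u &
    span_le m s : span_le n (u * (x * s))
| span_add n s t of span_le n s & span_le n t : span_le n (s + t).

Lemma span_leZ n c s : span_le n s -> span_le n (c *: s).
Proof.
elim=> {n s}[n u uI du|k m n u s lt uI du sS _|n s t _ IHs _ IHt].
- by apply: span_inv; [exact: sl2_fixedZ|exact: deg_leZ].
- rewrite scalerAl; apply: span_cons lt _ _ sS; first exact: sl2_fixedZ.
  exact: deg_leZ.
- by rewrite scalerDr; exact: span_add.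
Qed.

Lemma span_le_deg n s : span_le n s -> deg_le n s.
Proof.
elim=> {n s}[//|k m n u s lt uI du _ ds|n s t _ ds _ dt]; last exact: deg_leD.
apply: deg_leW lt _; rewrite -addnS; apply: deg_leM => //; exact: deg_le_x.
Qed.

Lemma span_le_D n s : span_le n s -> D s = 0.
Proof.
elim=> {n s}[n u uI _|k m n u s _ uI _ _ Ds|n s t _ Ds _ Dt].
- exact: D_sl2_fixed.
- by rewrite !DM D_sl2_fixed // Dx Ds !(mulr0, mul0r, addr0).
- by rewrite linearD /= Ds Dt addr0.
Qed.

Lemma span_leM k m n u s :
  (k + m <= n)%N -> sl2_fixed u -> deg_le k u -> span_le m s ->
  span_le n (u * s).
Proof.
move=> le uI du sS; elim: sS k u n le uI du => {m s}.
- move=> m v vI dv k u n le uI du; apply: span_inv; first exact: sl2_fixedM.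
  exact: deg_leW le (deg_leM du dv).
- move=> k' m' m v s lt vI dv sS _ k u n le uI du; rewrite mulrA.
  apply: (span_cons _ (sl2_fixedM uI vI) (deg_leM du dv) sS).
  by rewrite -addnA (leq_trans _ le) // -addnS leq_add2l.
- move=> m s t _ IHs _ IHt k u n le uI du; rewrite mulrDr.
  by apply: span_add; [exact: IHs le uI du|exact: IHt le uI du].
Qed.

(** Replacing the first [x] after a fixed factor by [y] gives the preimage
    [r].  That [x r - y D r] is again of the same form is what makes the
    induction of [ker_D_span_le] close up. *)
Lemma span_le_split n s : span_le n s -> exists u r,
  [/\ sl2_fixed u, s = u + D r, deg_le n r &
      span_le n.+1 (x * r - y * D r)].
Proof.
elim=> {n s}[n u uI _|k m n u s lt uI du sS _|n s t _ IHs _ IHt].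
- exists u, 0; rewrite linear0 addr0 !mulr0 subrr.
  by split=> //; [exact: deg_le0|apply: span_inv sl2_fixed0 (deg_le0 _)].
- exists 0, (u * (y * s)).
  have -> : D (u * (y * s)) = u * (x * s).
    by rewrite !DM D_sl2_fixed // (span_le_D sS) Dy mulr0 mul0r addr0 add0r.
  split; rewrite ?add0r //.
  + exact: sl2_fixed0.
  + apply: deg_leW lt _; rewrite -addnS; apply: deg_leM => //.
    exact: deg_le_y (span_le_deg sS).
  rewrite !mulrA -mulrBl; apply: (span_leM (k := k.+2) _ _ _ sS).
  + by rewrite !addSn.
  + exact: sl2_fixed_bracket.
  rewrite -scaleN1r; apply: deg_leD; last apply: deg_leZ; rewrite -mulrA.
    apply: deg_le_x; rewrite -addn1; apply: deg_leM => //.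
    by rewrite -[y]mulr1; apply: deg_le_y; exact: deg_le1.
  apply: deg_le_y; rewrite -addn1; apply: deg_leM => //.
  by rewrite -[x]mulr1; apply: deg_le_x; exact: deg_le1.
have [u [r [uI -> dr rS]]] := IHs; have [v [q [vI -> dq qS]]] := IHt.
exists (u + v), (r + q); split; [exact: sl2_fixedD|..|exact: deg_leD|].
  by rewrite linearD addrACA.
by rewrite linearD !mulrDr opprD addrACA; exact: span_add.
Qed.

(** Strip the first letter: [f = c + x a + y b] is a constant when [D a = - b]
    and [D b = 0].  One solution of the first equation is the [- r] of
    [span_le_split]; the difference [a + r] is a constant of smaller degree. *)
Lemma ker_D_span_le n f : deg_le n f -> D f = 0 -> span_le n f.
Proof.
elim: n f => [|n IH] f.
  move=> [c ->] _; apply: span_inv; first exact: sl2_fixedZ sl2_fixed1.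
  by exists c.
move=> [c [a [b [-> da db]]]].
rewrite !linearD linearZ /= !DM Dx Dy (leibniz1 DM) scaler0 add0r mul0r add0r.
rewrite addrA -mulrDr => /left_free[Dab Db].
have [u [r [uI eb dr rS]]] := span_le_split (IH b db Db).
have u0 : u = 0.
  apply: (sl2_fixed_im_D uI (z := - (a + r))).
  rewrite linearN linearD; apply/eqP; rewrite eq_sym -addr_eq0 addrCA -eb.
  exact/eqP.
have Dar : D (a + r) = 0 by apply: etrans Dab; rewrite linearD eb u0 add0r.
have -> : x * a + y * b = 1 * (x * (a + r)) + -1 *: (x * r - y * D r).
  rewrite eb u0 add0r mul1r scaleN1r opprB mulrDr.
  by rewrite [RHS]addrACA subrr addr0.
apply: span_add; last apply: span_add; last exact: span_leZ.
  apply: span_inv; first exact: sl2_fixedZ sl2_fixed1.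
  exact/deg_leZ/deg_le1.
apply: (span_cons (k := 0) _ sl2_fixed1 (deg_le1 0)); last first.
  by apply: IH Dar; exact: deg_leD.
by [].
Qed.

Lemma ker_D_gen f : D f = 0 <-> gen_subalg (fun a => a = x \/ sl2_fixed a) f.
Proof.
split=> [Df|].
  have [n df] := deg_le_ex f; elim: (ker_D_span_le df Df) => {df Df f n}.
  - by move=> n u uI _; apply: gen_subalg_in; right.
  - move=> k m n u s _ uI _ _ gs; apply: gen_subalg_M.
      by apply: gen_subalg_in; right.
    by apply: gen_subalg_M gs; apply: gen_subalg_in; left.
  - by move=> n s t _ gs _ gt; exact: gen_subalg_D.
elim=> [a [->|/D_sl2_fixed]||a b _ Da _ Db|c a _ Da|a b _ Da _ Db] //.
- exact: leibniz1.
- by rewrite linearD /= Da Db addr0.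
- by rewrite linearZ /= Da scaler0.
- by rewrite DM Da Db mul0r mulr0 addr0.
Qed.

End FreeAlgebra.

(** * The free algebra on two letters *)

Section Instance.

Variable K : fieldType.
Local Notation A := (freealg2 K).

Lemma delta_is_linear : linear (@delta K : A -> A).
Proof. by move=> c f g; rewrite deltaD deltaZ. Qed.

HB.instance Definition _ :=
  GRing.isLinear.Build K A A _ (@delta K) delta_is_linear.

Lemma gl2_act_is_linear m : linear (@gl2_act K m : A -> A).
Proof. by move=> c f g; rewrite gl2_actD gl2_actZ. Qed.

HB.instance Definition _ m :=
  GRing.isLinear.Build K A A _ (@gl2_act K m) (gl2_act_is_linear m).

Lemma gl2_act_is_monoid_morphism m : monoid_morphism (@gl2_act K m : A -> A).
Proof. by split; [exact: gl2_act1|exact: gl2_actM]. Qed.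

HB.instance Definition _ m :=
  GRing.isMonoidMorphism.Build A A (@gl2_act K m)
    (gl2_act_is_monoid_morphism m).

Lemma freealg2_left_ind (P : A -> Prop) :
  P 1 -> (forall f g, P f -> P g -> P (f + g)) ->
  (forall c f, P f -> P (c *: f)) ->
  (forall f, P f -> P (fx K * f)) -> (forall f, P f -> P (fy K * f)) ->
  forall f, P f.
Proof.
move=> P1 PD PZ Px Py; elim/freealg2_ind => [|f g|c [w]]; [|exact: PD|].
  by rewrite -(scale0r 1); exact: PZ.
rewrite -[c]mulr1 -freealg2_scaleU -subst_word_var; apply: PZ => /=.
elim: w => [|i s IH]; rewrite /subst_word ?big_nil // big_cons.
case: (unliftP 0 i) => [j|] ->; last exact: Px.
by rewrite (_ : lift 0 j = 1) ?(ord1 j); [exact: Py|exact/val_inj].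
Qed.

(** The cofactor of [X_i] in [f = c + \sum_i X_i f_i]. *)
Definition left_coef (i : 'I_2) : A -> A :=
  word_ext (fun w => if w is j :: w' then
    if j == i then subst_word (fvar K) w' else 0 else 0).

Lemma left_coef_mulX i j f :
  left_coef i (fvar K j * f) = if j == i then f else 0.
Proof.
elim/freealg2_ind: f => [|f g IHf IHg|c w].
- by rewrite mulr0 [LHS]word_ext0; case: ifP.
- rewrite mulrDr [LHS]word_extD [X in X + _]IHf [X in _ + X]IHg.
  by case: ifP; rewrite ?addr0.
rewrite [_ * _]freealg2_mulU mul1r [LHS]word_extU monalg.fmM monalg.fmU /=.
case: eqP => _; last exact: scaler0.
by rewrite subst_word_var freealg2_scaleU mulr1.
Qed.

Lemma freealg2_left_free (a b : A) :
  fx K * a + fy K * b = 0 -> a = 0 /\ b = 0.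
Proof.
move=> e; split.
  have := congr1 (left_coef 0) e; rewrite [LHS]word_extD [RHS]word_ext0.
  by rewrite [X in X + _]left_coef_mulX [X in _ + X]left_coef_mulX addr0.
have := congr1 (left_coef 1) e; rewrite [LHS]word_extD [RHS]word_ext0.
by rewrite [X in X + _]left_coef_mulX [X in _ + X]left_coef_mulX add0r.
Qed.

Lemma gl2_act_var2 m j :
  gl2_act m (fvar K j) = m 0 j *: fx K + m 1 j *: fy K.
Proof. exact: etrans (gl2_act_var _ _) (sum_ord2 _). Qed.

End Instance.

Unset Implicit Arguments.

Theorem corollary5p5 (K : fieldType) (charK0 : [pchar K] =i pred0)
    (f : freealg2 K) :
  delta f = 0 <->
  gen_subalg (fun a : freealg2 K => a = fx K \/ sl2_invariant a) f.
Proof.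
exact: (@ker_D_gen K (freealg2 K) (fx K) (fy K) (@delta K) (@gl2_act K)
  (@freealg2_left_ind K) (@freealg2_left_free K) (@deltaM K) (delta_x K)
  (delta_y K) (fun m => gl2_act_var2 m 0) (fun m => gl2_act_var2 m 1)
  charK0 f).
Qed.
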